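(* Let $G = (I \cup C, E)$ be a split comparability graph. Then $\mathcal{R}^p(G) \le 3$. Moreover, $\mathcal{R}^p(G) = 3$ if and only if $G$ contains the graph $B_4$ as an induced subgraph.
   Context: All graphs are finite and simple. A split graph is a graph whose vertex set can be partitioned as $I \cup C$ with $I$ an independent set and $C$ a clique (taken inclusion-wise maximal, i.e. no vertex of $I$ is adjacent to all vertices of $C$). A comparability graph is a graph admitting a transitive orientation (an orientation such that whenever $\overrightarrow{ab}$ and $\overrightarrow{bc}$ are arcs, $\overrightarrow{ac}$ is an arc). A split comparability graph is a split graph that is a comparability graph. Two letters $a, b$ alternate in a word $w$ if the subword of $w$ obtained by keeping only the letters $a$ and $b$ is of the form $abab\cdots$ or $baba\cdots$ (of even or odd length). A word $w$ over the vertex set $V$ of a graph $G$ represents $G$ if for all distinct $a, b \in V$, $a$ and $b$ are adjacent in $G$ if and only if they alternate in $w$. $G$ is permutationally $k$-representable ($k \ge 1$) if it is represented by a word of the form $p_1 p_2 \cdots p_k$ where each $p_i$ is a permutation of $V$ (a word in which each vertex occurs exactly once). The permutation-representation number $\mathcal{R}^p(G)$ of a comparability graph $G$ is the smallest $k$ such that $G$ is permutationally $k$-representable. $B_4$ is the graph with vertex set $\{1,2,3,4,5,6,7\}$ in which $1,2,3,4$ are pairwise adjacent, $5$ is adjacent exactly to $3$ and $4$, $6$ is adjacent exactly to $2$ and $3$, and $7$ is adjacent exactly to $1$ and $4$. *)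

(* Defs.v *)
From mathcomp Require Import all_boot.

Set Implicit Arguments.
Unset Strict Implicit.
Unset Printing Implicit Defensive.

Record sgraph := SGraph {
  vertex :> finType;
  adj : rel vertex;
  adj_sym : symmetric adj;
  adj_irr : irreflexive adj
}.

Definition independent (G : sgraph) (A : {set G}) : Prop :=
  {in A &, forall x y, ~~ adj x y}.

Definition clique (G : sgraph) (A : {set G}) : Prop :=
  {in A &, forall x y, x != y -> adj x y}.

(* The last condition says that the clique C is inclusion-wise maximal. *)
Definition split_partition (G : sgraph) (I C : {set G}) : Prop :=
  [/\ I :|: C = [set: G], [disjoint I & C], independent I, clique C &
      forall x, x \in I -> exists2 y, y \in C & ~~ adj x y].

(* o x y means that the edge xy is oriented from x to y. *)
Definition orientation (G : sgraph) (o : rel G) : Prop :=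
  forall x y, adj x y = (o x y || o y x) /\ ~~ (o x y && o y x).

Definition comparability (G : sgraph) : Prop :=
  exists2 o : rel G, orientation o & transitive o.

Definition altword (T : Type) (a b : T) (n : nat) : seq T :=
  mkseq (fun i => if odd i then b else a) n.

Definition alternate (T : eqType) (a b : T) (w : seq T) : Prop :=
  exists n, filter (pred2 a b) w = altword a b n \/
            filter (pred2 a b) w = altword b a n.

Definition represents (G : sgraph) (w : seq G) : Prop :=
  forall a b : G, a != b -> (adj a b <-> alternate a b w).

Definition is_permutation (T : finType) (p : seq T) : Prop :=
  forall x : T, count_mem x p = 1.

Definition perm_representable (G : sgraph) (k : nat) : Prop :=
  0 < k /\
  exists ps : seq (seq G),
    [/\ size ps = k, forall p, p \in ps -> is_permutation p &
        represents (flatten ps)].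

(* R^p(G) = k, as a relation, so that no value is assigned to a graph that is
   not permutationally representable. *)
Definition perm_rep_number (G : sgraph) (k : nat) : Prop :=
  perm_representable G k /\ forall j, perm_representable G j -> k <= j.

Definition induced_subgraph (H G : sgraph) : Prop :=
  exists2 f : H -> G, injective f & forall x y, adj (f x) (f y) = adj x y.

Definition B4_edges : seq (nat * nat) :=
  [:: (1, 2); (1, 3); (1, 4); (2, 3); (2, 4); (3, 4);
      (5, 3); (5, 4); (6, 2); (6, 3); (7, 1); (7, 4)].

(* The ordinal i : 'I_7 stands for the vertex labelled i + 1. *)
Definition B4_adj : rel 'I_7 := fun i j =>
  ((i.+1, j.+1) \in B4_edges) || ((j.+1, i.+1) \in B4_edges).

Fact B4_adj_sym : symmetric B4_adj.
Proof. by move=> i j; rewrite /B4_adj orbC. Qed.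

Fact B4_adj_irr : irreflexive B4_adj.
Proof. by case; do 7?[case=> //]. Qed.

Definition B4 : sgraph := SGraph B4_adj_sym B4_adj_irr.

(* Main.v *)
Require Import Defs.
From mathcomp Require Import all_boot all_order.
From mathcomp Require Import zify.
Import Order.Theory.

Set Implicit Arguments.
Unset Strict Implicit.
Unset Printing Implicit Defensive.

(** A word made of [k] permutations that represents a graph amounts to [k] linear
    orders such that two vertices are compared the same way by all of them
    exactly when they are adjacent ([perm_representableP]).  So an upper bound
    [k] follows from [k] linear extensions of an orientation of the graph that
    between them order every nonadjacent pair in both ways
    ([perm_representable_of_keys]); such a pair is called reversed below.

    Orient a split comparability graph.  The clique [C] is a chain, and a vertex
    [x] outside [C] is above an initial segment of it and below a final segment;
    the lengths of these segments are recorded by two gaps of the chain,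
    [low_gap x <= high_gap x], between which [x] may be inserted.  Since no two
    vertices outside [C] are adjacent, transitivity even gives
    [low_gap x <= high_gap y] for all such [x] and [y] ([low_le_high]), so all
    these intervals share a gap.  To reverse all pairs formed by [x] and a
    clique element with two orders, [x] has to sit in its low gap in one and in
    its high gap in the other.  Two vertices put at opposite ends are reversed
    automatically because their intervals meet.  Two vertices put at the same
    ends are reversed, with suitable tie-breaking, unless they cross: both gaps
    of one are strictly smaller than those of the other.

    Three orders always suffice: insert all vertices low, then all high, and use
    a third order to reverse the crossing pairs inside a common gap
    ([representable3]).  Two orders suffice if the crossing relation can be
    2-coloured.  It is a strict partial order, so it can be as soon as it has no
    chain of three elements: separate the minimal elements from the others
    ([representable2]).  A chain of three crossing vertices, with one clique
    element taken from each of the four jumps of the gaps along it, spans an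
    induced [B4] ([crossing_chain_B4]).

    Conversely two orders cannot represent [B4]: each of the vertices 5, 6, 7
    would have to choose an end in the first order, and any two of them would
    have to choose differently ([B4_not_2_representable]). *)

(** * Words made of permutations, as families of linear orders *)

Definition before (T : eqType) (a b : T) (p : seq T) := index a p < index b p.

Lemma before_trans (T : eqType) (p : seq T) (a b c : T) :
  before a b p -> before b c p -> before a c p.
Proof. exact: ltn_trans. Qed.

Lemma is_permutation_mem (T : finType) (p : seq T) :
  is_permutation p -> forall x, x \in p.
Proof. by move=> pP x; rewrite -has_pred1 has_count pP. Qed.

Lemma is_permutation_uniq (T : finType) (p : seq T) :
  is_permutation p -> uniq p.
Proof.
by move=> pP; apply: count_mem_uniq => x; rewrite pP is_permutation_mem.
Qed.

Lemma before_asym (T : finType) (p : seq T) (a b : T) :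
  is_permutation p -> a != b -> before b a p = ~~ before a b p.
Proof.
move=> pP neq_ab; rewrite /before -leqNgt ltn_neqAle.
suff -> : index b p != index a p by [].
apply: contra neq_ab => /eqP eq_i; apply/eqP.
by rewrite -(nth_index a (is_permutation_mem pP a)) -eq_i nth_index //
  is_permutation_mem.
Qed.

Lemma filter_pred2_permutation (T : finType) (p : seq T) (a b : T) :
  is_permutation p -> a != b ->
  filter (pred2 a b) p = if before a b p then [:: a; b] else [:: b; a].
Proof.
move=> pP neq_ab.
wlog lt_ab : a b neq_ab / before a b p => [IH|].
  case: ifP => [lt_ab|/negbT]; first by rewrite IH // lt_ab.
  rewrite -before_asym // => lt_ba.
  have /IH-/(_ lt_ba) : b != a by rewrite eq_sym.
  by rewrite lt_ba => <-; apply: eq_filter => x; rewrite /= orbC.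
rewrite lt_ab; move: lt_ab (is_permutation_uniq pP); rewrite /before.
case/splitPr: (is_permutation_mem pP a) (is_permutation_mem pP b) => p1 p2.
rewrite mem_cat inE [b == a]eq_sym (negPf neq_ab) /= => b_in lt_ab.
rewrite cat_uniq /= negb_or => /and3P[_ /andP[a1 _] /andP[a2 u2]].
have b1 : b \notin p1.
  apply/negP => b1; move: lt_ab; rewrite !index_cat b1 (negPf a1).
  by apply/negP; rewrite -leqNgt (leq_trans (index_size _ _)) // leq_addr.
have nil (s : seq T) : a \notin s -> b \notin s -> filter (pred2 a b) s = [::].
  move=> aNs bNs; apply/eqP; rewrite -(negbK (_ == _)) -has_filter.
  by apply/hasPn => x xs /=; apply/norP; split;
    apply: contraTneq xs => ->.
move: b_in a2 u2; rewrite (negPf b1) /= => b2.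
case/splitPr: b2 => q1 q2; rewrite mem_cat inE !negb_or cat_uniq /= negb_or.
case/and3P=> aq1 _ aq2 /and3P[_ /andP[bq1 _] /andP[bq2 _]].
by rewrite filter_cat /= eqxx filter_cat /= eqxx orbT !nil.
Qed.

Lemma filter_pred2_flatten (T : finType) (ps : seq (seq T)) (a b : T) :
  {in ps, forall p, is_permutation p} -> a != b ->
  filter (pred2 a b) (flatten ps) =
  flatten [seq if before a b p then [:: a; b] else [:: b; a] | p <- ps].
Proof.
move=> psP neq_ab; elim: ps psP => //= p ps IH psP.
rewrite filter_cat filter_pred2_permutation ?IH // => [q q_ps|].
  by apply: psP; rewrite inE q_ps orbT.
by apply: psP; rewrite mem_head.
Qed.

Lemma altword_rec (T : Type) (a b : T) (n : nat) :
  altword a b n.+1 = a :: altword b a n.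
Proof.
rewrite /altword /mkseq /= -[1]addn0 iotaDl -map_comp; congr (_ :: _).
by apply: eq_map => i /=; case: odd.
Qed.

(** The blocks [ab] and [ba] concatenate to an alternating word starting with
    [a] only if no block is [ba]: the first change of orientation would repeat
    a letter. *)
Lemma altword_pairs (T : eqType) (a b : T) (bs : seq bool) : a != b ->
  (exists n, flatten [seq if c then [:: a; b] else [:: b; a] | c <- bs]
             = altword a b n) <-> all id bs.
Proof.
move=> neq_ab; split.
  elim: bs => //= c bs IH [[|n]]; first by case: c.
  rewrite altword_rec; case: n => [|n]; first by case: c.
  rewrite altword_rec; case: c => /= [[eq_w]|[/esym/eqP]].
    by apply: IH; exists n.
  by rewrite (negPf neq_ab).
elim: bs => [|c bs IH] /=; first by exists 0.
by case/andP=> -> /IH[n ->]; exists n.+2; rewrite !altword_rec.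
Qed.

Lemma alternate_permutations (T : finType) (ps : seq (seq T)) (a b : T) :
  {in ps, forall p, is_permutation p} -> a != b ->
  alternate a b (flatten ps) <-> all (before a b) ps || all (before b a) ps.
Proof.
move=> psP neq_ab.
have pair_eq (c d : T) : c != d ->
    filter (pred2 c d) (flatten ps) =
    flatten [seq if x then [:: c; d] else [:: d; c] | x <- map (before c d) ps].
  by move=> neq_cd; rewrite -map_comp filter_pred2_flatten.
have alt (c d : T) : c != d ->
    (exists n, filter (pred2 c d) (flatten ps) = altword c d n) <->
    all (before c d) ps.
  by move=> neq_cd; rewrite pair_eq // altword_pairs // all_map.
have neq_ba : b != a by rewrite eq_sym.
have swap : filter (pred2 a b) (flatten ps) = filter (pred2 b a) (flatten ps).
  by apply: eq_filter => x /=; rewrite orbC.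
split.
  case=> n [eq_w|eq_w]; apply/orP; first by left; apply/alt => //; exists n.
  by right; apply/alt => //; exists n; rewrite -swap.
case/orP=> [/(alt _ _ neq_ab)|/(alt _ _ neq_ba)] [n eq_w].
  by exists n; left.
by exists n; right; rewrite swap.
Qed.

Lemma perm_representableP (G : sgraph) (k : nat) :
  perm_representable G k <->
  0 < k /\ exists ps : seq (seq G),
    [/\ size ps = k, {in ps, forall p, is_permutation p} &
        forall a b, a != b ->
          adj a b = all (before a b) ps || all (before b a) ps].
Proof.
split=> -[k_gt0 [ps [sz psP rep]]]; split=> //;
  exists ps; split=> // a b neq_ab.
  by apply/idP/idP => [/(rep a b neq_ab)|] /(alternate_permutations psP neq_ab)
    // /(rep a b neq_ab).
by rewrite rep //; apply: iff_sym; apply: alternate_permutations.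
Qed.

(** * Linear extensions given by keys *)

Definition key_perm (d : Order.disp_t) (T : orderType d) (V : finType)
  (key : V -> T) : seq V := sort (relpre key <=%O) (enum V).

Lemma key_perm_is_permutation (d : Order.disp_t) (T : orderType d)
  (V : finType) (key : V -> T) : is_permutation (key_perm key).
Proof.
by move=> x; rewrite count_uniq_mem ?sort_uniq ?enum_uniq // mem_sort mem_enum.
Qed.

(** The key need not be injective: strict comparisons of keys are all that is
    read off, so unresolved ties are harmless. *)
Lemma key_perm_before (d : Order.disp_t) (T : orderType d)
  (V : finType) (key : V -> T) (u v : V) :
  (key u < key v)%O -> before u v (key_perm key).
Proof.
move=> lt_uv; have := key_perm_is_permutation key; set p := key_perm key => pP.
have neq_uv : v != u by apply: contraTneq lt_uv => ->; rewrite ltxx.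
rewrite (before_asym pP neq_uv); apply/negP => lt_vu.
have: (key v <= key u)%O.
  apply: (@sorted_ltn_index _ (relpre key <=%O) _ p) lt_vu;
    rewrite ?is_permutation_mem //.
  - by move=> y x z; apply: le_trans.
  - by apply: sort_sorted => x y; apply: le_total.
by rewrite leNgt lt_uv.
Qed.

(** This is how the dimension of a partial order is bounded: the keys refine the
    orientation, and between them they reverse every nonadjacent pair, the two
    ways being the instances [(u, v)] and [(v, u)] of the last hypothesis. *)
Lemma perm_representable_of_keys (G : sgraph) (o : rel G) (d : Order.disp_t)
  (T : orderType d) (ks : seq (G -> T)) :
  orientation o -> 0 < size ks ->
  (forall u v, o u v -> all (fun k => (k u < k v)%O) ks) ->
  (forall u v, u != v -> ~~ adj u v -> has (fun k => (k u < k v)%O) ks) ->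
  perm_representable G (size ks).
Proof.
move=> oP ks_gt0 ext rev; apply/perm_representableP; split=> //.
exists [seq key_perm k | k <- ks]; split=> [|p|a b neq_ab].
- by rewrite size_map.
- elim: ks {ks_gt0 ext rev} => //= k ks IH; rewrite inE => /orP[/eqP->|//].
  exact: key_perm_is_permutation.
have extP u v : o u v -> all (before u v) [seq key_perm k | k <- ks].
  move/ext; rewrite all_map; apply: sub_all => k.
  exact: key_perm_before.
have revP u v : u != v -> ~~ adj u v ->
    ~~ all (before v u) [seq key_perm k | k <- ks].
  move=> neq_uv /(rev _ _ neq_uv); rewrite -has_predC has_map; apply: sub_has.
  move=> k /key_perm_before /=; rewrite (before_asym _ neq_uv) ?negbK //.
  exact: key_perm_is_permutation.
case: (boolP (adj a b)) => [|nadj].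
  by rewrite (oP a b).1 => /orP[] /extP ->; rewrite ?orbT.
have neq_ba : b != a by rewrite eq_sym.
by apply/esym/negbTE/norP; split; apply: revP; rewrite // adj_sym.
Qed.

(** * The graph B4 needs three permutations *)

(** Adjacent vertices appear in the same order in [p] and [q], nonadjacent ones
    in opposite orders.  If [x] were between [y] and [z] in [p], then it would be
    between them in [q] with the roles of [y] and [z] exchanged, although [y]
    and [z] keep their order. *)
Lemma before_fork (G : sgraph) (p q : seq G) (x y z : G) :
  is_permutation p -> is_permutation q ->
  (forall a b, a != b -> adj a b = (before a b p == before a b q)) ->
  x != y -> x != z -> y != z ->
  ~~ adj x y -> ~~ adj x z -> adj y z -> before x y p = before x z p.
Proof.
move=> pP qP rep xy xz yz.
have yx : y != x by rewrite eq_sym.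
have zx : z != x by rewrite eq_sym.
have zy : z != y by rewrite eq_sym.
have ry := rep _ _ yz.
rewrite !rep //.
have tp := before_trans (p := p); have tq := before_trans (p := q).
have := tp x y z. have := tp x z y. have := tp y x z. have := tp z x y.
have := tq x y z. have := tq x z y. have := tq y x z. have := tq z x y.
have := tp y z x; have := tp z y x; have := tq y z x; have := tq z y x.
rewrite !(before_asym pP xy) !(before_asym pP yz) !(before_asym pP xz).
rewrite !(before_asym qP xy) !(before_asym qP yz) !(before_asym qP xz).
by do 6!case: before => //=; intuition.
Qed.

(** The vertices of [B4] by their labels 1 to 7. *)
Definition B4v (n : nat) : B4 := inord n.-1.

(** The clique elements not adjacent to 5 (resp. 6, 7) are 1 and 2 (resp. 1 and
    4, 2 and 3); forks put them all on the same side of it in the first order.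
    Forks also link that side to the relative order of 5, 6 and 7, in such a
    way that any two of these three vertices have their clique non-neighbours
    on opposite sides, which is impossible for three vertices. *)
Lemma B4_not_2_representable (G : sgraph) :
  induced_subgraph B4 G -> ~ perm_representable G 2.
Proof.
case=> f f_inj f_adj /perm_representableP[_ [ps [sz psP rep]]].
case: ps sz psP rep => [|p [|q [|? ?]]] //= _ psP rep.
have pP : is_permutation p by apply: psP; rewrite mem_head.
have qP : is_permutation q by apply: psP; rewrite !inE eqxx orbT.
have rep2 a b : a != b -> adj a b = (before a b p == before a b q).
  move=> neq_ab; rewrite rep // !andbT.
  by rewrite (before_asym pP neq_ab) (before_asym qP neq_ab); do 2!case: before.
pose g n := f (B4v n); pose s i j := before (g i) (g j) p.
pose e i j := ((i, j) \in B4_edges) || ((j, i) \in B4_edges).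
have neq i j : [&& 0 < i <= 7, 0 < j <= 7 & i != j] -> g i != g j.
  case: i j => [|i] [|j]; rewrite ?andbF //= => /and3P[li lj].
  apply: contra => /eqP/f_inj.
  by move/(congr1 (@nat_of_ord 7)); rewrite !inordK // => /= ->.
have adjE i j : 0 < i <= 7 -> 0 < j <= 7 -> adj (g i) (g j) = e i j.
  by case: i j => [|i] [|j] //= li lj; rewrite f_adj /= /B4_adj !inordK.
have fork i j k :
    [&& 0 < i <= 7, 0 < j <= 7, 0 < k <= 7 & [&& i != j, i != k & j != k]] ->
    [&& ~~ e i j, ~~ e i k & e j k] -> s i j = s i k.
  case/and4P=> li lj lk /and3P[ij ik jk] /and3P[nij nik jk_adj].
  by apply: (before_fork pP qP rep2); rewrite ?neq ?adjE ?li ?lj ?lk.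
have opp i j : [&& 0 < i <= 7, 0 < j <= 7 & i != j] -> s j i = ~~ s i j.
  by move=> ij; apply: before_asym => //; apply: neq.
(* For 5 and 6, the fork at 5 is towards 2 and 6, the one at 6 towards 4 and 5. *)
have s56 : s 6 4 = ~~ s 5 2.
  by rewrite -(fork 6 5 4) // (opp 5 6) // (fork 5 6 2).
have s57 : s 7 3 = ~~ s 5 1.
  by rewrite -(fork 7 5 3) // (opp 5 7) // (fork 5 7 1).
have s67 : s 7 2 = ~~ s 6 1.
  by rewrite -(fork 7 6 2) // (opp 6 7) // (fork 6 7 1).
move: s56 s57 s67; rewrite (fork 6 4 1) // (fork 5 2 1) // (fork 7 3 2) //.
by do 3!case: (s _ _).
Qed.

Lemma perm_representable1 (G : sgraph) :
  perm_representable G 1 <-> forall a b : G, a != b -> adj a b.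
Proof.
split=> [/perm_representableP[_ [[|p [|? ?]] [] // _ psP rep]] a b neq_ab|cpl].
  rewrite rep // /= !andbT (before_asym _ neq_ab) ?orbN //.
  by apply: psP; rewrite mem_head.
have pP : is_permutation (enum G).
  by move=> x; rewrite count_uniq_mem ?enum_uniq // mem_enum.
apply/perm_representableP; split=> //; exists [:: enum G].
split=> // [p|a b neq_ab]; first by rewrite inE => /eqP->.
by rewrite cpl //= !andbT (before_asym pP neq_ab) orbN.
Qed.

Lemma perm_representable_B4 (G : sgraph) (j : nat) :
  induced_subgraph B4 G -> perm_representable G j -> 3 <= j.
Proof.
move=> B4G; case: j => [|[|[|//]]]; first by case.
  case: B4G => f f_inj f_adj /perm_representable1/(_ (f (B4v 5)) (f (B4v 1))).
  rewrite (inj_eq f_inj) f_adj /= /B4_adj -val_eqE /= !inordK //= => adj51.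
  by have := adj51 isT.
by move/(B4_not_2_representable B4G).
Qed.

(** * The gaps of the clique in which a vertex can be inserted *)

Section SplitComparability.

Variables (G : sgraph) (C : {set G}) (o : rel G).
Hypotheses (oP : orientation o) (o_trans : transitive o).
Hypotheses (C_clique : clique C) (I_indep : independent (~: C)).

(** Gap number [n] is the one above exactly [n] elements of the chain [C].
    Below [low_gap v] lie the clique elements that must precede [v], above
    [high_gap v] those that must follow it.  Both make sense for [v] in [C] too,
    where they are the gaps just below and just above [v]. *)
Definition low_gap (v : G) := #|[set c in C | o c v]|.
Definition high_gap (v : G) := #|[set c in C | ~~ o v c]|.

Lemma orientation_asym (u v : G) : o u v -> ~~ o v u.
Proof. by move=> uv; have [_] := oP u v; rewrite uv. Qed.

Lemma orientation_irr (v : G) : o v v = false.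
Proof. by apply/negP => vv; have := orientation_asym vv; rewrite vv. Qed.

Lemma clique_total (c c' : G) : c \in C -> c' \in C -> c != c' ->
  ~~ o c c' -> o c' c.
Proof.
by move=> cC c'C neq; have := C_clique cC c'C neq; rewrite (oP c c').1; case: o.
Qed.

Lemma independent_nonadj (x y : G) : x \notin C -> y \notin C -> ~~ adj x y.
Proof. by move=> xC yC; apply: I_indep; rewrite inE. Qed.

(** The clique elements below [v] form an initial segment of the chain [C], by
    transitivity, so membership is decided by counting.  This includes [v] in
    [C], for which it compares ranks in the chain. *)
Lemma below_clique (c v : G) : c \in C -> o c v = (low_gap c < low_gap v).
Proof.
move=> cC; apply/idP/idP => [cv|].
  apply: proper_card; apply/properP; split.
    by apply/subsetP => b; rewrite !inE => /andP[-> /o_trans->].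
  by exists c; rewrite !inE cC ?cv // orientation_irr.
apply: contraTT => ncv; rewrite -leqNgt; apply: subset_leq_card.
apply/subsetP => b; rewrite !inE => /andP[bC bv]; rewrite bC.
apply: clique_total => //; first by apply: contraTneq bv => <-.
by apply: contra ncv => cb; apply: o_trans bv.
Qed.

Lemma above_clique (c v : G) : c \in C -> o v c = (high_gap v <= low_gap c).
Proof.
move=> cC; apply/idP/idP => [vc|].
  apply: subset_leq_card.
  apply/subsetP => b; rewrite !inE => /andP[bC nvb]; rewrite bC.
  apply: clique_total => //; first by apply: contraNneq nvb => <-.
  by apply: contra nvb; apply: o_trans.
apply: contraTT => nvc; rewrite -ltnNge; apply: proper_card.
apply/properP; split.
  apply/subsetP => b; rewrite !inE => /andP[-> bc] /=.
  by apply: contra nvc => vb; apply: o_trans bc.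
by exists c; rewrite !inE cC // orientation_irr.
Qed.

(** A clique element below [u] and above [v] would make [u] and [v] adjacent. *)
Lemma low_le_high (u v : G) :
  u \notin C -> v \notin C -> low_gap u <= high_gap v.
Proof.
move=> uC vC; apply: subset_leq_card; apply/subsetP => c; rewrite !inE.
case/andP=> -> cu /=; apply/negP => vc.
have := independent_nonadj vC uC; rewrite (oP v u).1.
by rewrite (o_trans vc cu).
Qed.

(** * Linear extensions obtained by inserting vertices in gaps *)

(** Even first entries are gaps and odd ones clique elements: gap [n] gets [2n],
    and the clique element between the gaps [n] and [n + 1] gets [2n + 1].  The
    remaining entries, compared lexicographically, order the vertices inserted
    in the same gap. *)
Definition gap_key (gap : G -> nat) (tie : G -> seq nat) (v : G) :
    seqlexi nat :=
  if v \in C then [:: (low_gap v).*2.+1] else (gap v).*2 :: tie v.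

Definition linear_extension (k : G -> seqlexi nat) :=
  forall u v, o u v -> (k u < k v)%O.

Lemma gap_key_extension gap tie :
  (forall x, x \notin C -> low_gap x <= gap x <= high_gap x) ->
  linear_extension (gap_key gap tie).
Proof.
move=> gapP u v; rewrite /gap_key.
case: (boolP (u \in C)) (boolP (v \in C)) => uC [] vC; last first.
- move=> uv; have := independent_nonadj uC vC.
  by rewrite (oP u v).1 uv.
- by have := gapP u uC; rewrite above_clique // ltxi_cons !leEnat; lia.
- by have := gapP v vC; rewrite below_clique // ltxi_cons !leEnat; lia.
- by rewrite below_clique // ltxi_cons !leEnat; lia.
Qed.

(** * Reversing the pairs that do not cross *)

Definition crosses (x y : G) :=
  (low_gap x < low_gap y) && (high_gap x < high_gap y).

Definition rev_rank (v : G) : nat := #|G| - enum_rank v.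

(** The tie-breaking entries matter when two vertices share a gap.  Those using
    it as their low gap come before those using it as their high gap.  Among
    vertices using it at the same end, the order is opposite to that of their
    other ends, because these decide the order of the pair when the roles of the
    ends are exchanged. *)
Definition placement_key (rank : G -> nat) (high : pred G) : G -> seqlexi nat :=
  gap_key (fun x => if high x then high_gap x else low_gap x)
    (fun x => [:: nat_of_bool (high x);
                  #|C| - (if high x then low_gap x else high_gap x); rank x]).

(** The two orders use opposite ends for every vertex and, for vertices with both
    gaps equal, opposite ranks. *)
Definition first_key (high : pred G) :=
  placement_key (fun v => enum_rank v) high.
Definition second_key (high : pred G) := placement_key rev_rank (predC high).

Lemma high_gap_le (v : G) : high_gap v <= #|C|.
Proof.
by apply: subset_leq_card; apply/subsetP => c; rewrite inE => /andP[].
Qed.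

Lemma placement_key_extension rank high :
  linear_extension (placement_key rank high).
Proof.
apply: gap_key_extension => x xC.
by have := low_le_high xC xC; case: (high x); rewrite leqnn ?andbT.
Qed.

(** The clique elements not adjacent to [x] lie between its two gaps, so [x]
    passes over them when it moves from one end to the other. *)
Lemma clique_nonadj_reversed (high : pred G) (c x : G) :
  c \in C -> x \notin C -> ~~ adj c x ->
  has (fun k => (k c < k x)%O) [:: first_key high; second_key high] &&
  has (fun k => (k x < k c)%O) [:: first_key high; second_key high].
Proof.
move=> cC xC; rewrite (oP c x).1 below_clique // above_clique //.
rewrite /= /first_key /second_key /placement_key /gap_key cC (negPf xC) /=.
by case: (high x) => /=; rewrite !ltxi_cons !leEnat; lia.
Qed.

(** At opposite ends, the vertex in its low gap comes first since any low gap is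
    at most any high gap, and the roles are exchanged in the other order.  At the
    same end, [x] comes after [y] in both orders only if both gaps of [y] are
    smaller, ties being broken against the order of the other gaps. *)
Lemma independent_reversed (high : pred G) (x y : G) :
  x \notin C -> y \notin C -> x != y ->
  ~~ ((high x == high y) && crosses y x) ->
  has (fun k => (k x < k y)%O) [:: first_key high; second_key high].
Proof.
move=> xC yC neq_xy.
have neq_r : enum_rank x != enum_rank y :> nat.
  by apply: contra neq_xy => /eqP/ord_inj/enum_rank_inj ->.
have := low_le_high xC yC; have := low_le_high yC xC.
have rank_lt (v : G) : enum_rank v < #|G| by apply: ltn_ord.
have := rank_lt x; have := rank_lt y; move: neq_r.
have := high_gap_le x; have := high_gap_le y.
have := low_le_high xC xC; have := low_le_high yC yC.
rewrite /= /first_key /second_key /placement_key /gap_key /=.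
rewrite (negPf xC) (negPf yC) /= /crosses /rev_rank !ltxi_cons !leEnat ltxx /=.
move: (enum_rank x : nat) (enum_rank y : nat) => rx ry.
move: #|G| #|C|
      (low_gap x) (low_gap y) (high_gap x) (high_gap y).
by case: (high x); case: (high y) => /=; lia.
Qed.

(** * Three orders always suffice *)

(** A gap common to the intervals of all vertices outside [C]. *)
Definition top := \max_(x | x \notin C) low_gap x.

Definition middle_key : G -> seqlexi nat :=
  gap_key (fun=> top) (fun x => [:: #|C| - low_gap x]).

Lemma middle_key_extension : linear_extension middle_key.
Proof.
apply: gap_key_extension => x xC; rewrite leq_bigmax_cond //=.
by apply/bigmax_leqP => y yC; apply: low_le_high.
Qed.

(** Crossing pairs are the only ones left unreversed when every vertex is at the
    same end; in the middle gap, decreasing order of low gaps reverses them. *)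
Lemma representable3 : perm_representable G 3.
Proof.
apply: (perm_representable_of_keys
          (ks := [:: middle_key; first_key pred0; second_key pred0]) oP) => //.
  by move=> u v uv /=; rewrite middle_key_extension ?placement_key_extension.
move=> u v neq_uv nadj.
suff: (middle_key u < middle_key v)%O ||
      has (fun k => (k u < k v)%O) [:: first_key pred0; second_key pred0] by [].
case: (boolP (u \in C)) (boolP (v \in C)) => uC [] vC.
- by move: nadj; rewrite C_clique.
- by have /andP[-> _] := clique_nonadj_reversed pred0 uC vC nadj; rewrite orbT.
- move: nadj; rewrite adj_sym => /(clique_nonadj_reversed pred0 vC uC).
  by case/andP=> _ ->; rewrite orbT.
case: (boolP (crosses v u)) => [/andP[lt_lo _]|ncross]; last first.
  by rewrite (@independent_reversed pred0) ?orbT // eqxx.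
rewrite /middle_key /gap_key (negPf uC) (negPf vC) !ltxi_cons !leEnat.
have := high_gap_le u; have := low_le_high uC uC; lia.
Qed.

(** * Two orders suffice unless three vertices cross in a chain *)

Definition crossed (x : G) := [exists y in ~: C, crosses y x].

(** The vertices which are not minimal for crossing are placed high first.  If
    [v] crosses [u] and both are on the same side, then [v] is not minimal, and a
    vertex crossing it gives a chain of three. *)
Lemma representable2 :
  (forall x y z, x \notin C -> y \notin C -> z \notin C ->
     crosses x y -> crosses y z -> False) ->
  perm_representable G 2.
Proof.
move=> no_chain.
apply: (perm_representable_of_keys
          (ks := [:: first_key crossed; second_key crossed]) oP) => //.
  by move=> u v uv /=; rewrite !placement_key_extension.
move=> u v neq_uv nadj.
case: (boolP (u \in C)) (boolP (v \in C)) => uC [] vC.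
- by move: nadj; rewrite C_clique.
- by have /andP[] := clique_nonadj_reversed crossed uC vC nadj.
- move: nadj; rewrite adj_sym => /(clique_nonadj_reversed crossed vC uC).
  by case/andP.
apply: independent_reversed => //; apply/negP => /andP[/eqP eq_uv vu].
have: crossed u by apply/existsP; exists v; rewrite inE vC.
rewrite eq_uv => /existsP[w /andP[]]; rewrite inE => wC wv.
exact: (no_chain w v u).
Qed.

(** Both strict inequalities of a crossing are jumps over a clique element: one
    that is below [y] but not below [x], and one that is above [x] but not above
    [y]. *)
Lemma crosses_witnesses (x y : G) : crosses x y ->
  (exists2 c, c \in C & low_gap x <= low_gap c < low_gap y) /\
  (exists2 c, c \in C & high_gap x <= low_gap c < high_gap y).
Proof.
case/andP=> lt_lo lt_hi; split.
  have /subsetPn[c]: ~~ ([set c in C | o c y] \subset [set c in C | o c x]).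
    by apply: contraL lt_lo => /subset_leq_card; rewrite leqNgt.
  rewrite !inE => /andP[cC cy]; rewrite cC /= below_clique // -leqNgt => le.
  by exists c => //; rewrite le -below_clique.
have /subsetPn[c]: ~~ ([set c in C | ~~ o y c] \subset [set c in C | ~~ o x c]).
  by apply: contraL lt_hi => /subset_leq_card; rewrite leqNgt.
rewrite !inE => /andP[cC]; rewrite cC /= negbK above_clique // -ltnNge => lt.
by rewrite above_clique // => le; exists c => //; rewrite le.
Qed.

Lemma high_gap_clique (c : G) : c \in C -> high_gap c = (low_gap c).+1.
Proof.
move=> cC; apply/eqP; rewrite eqn_leq; apply/andP; split; last first.
  by rewrite ltnNge -above_clique // orientation_irr.
rewrite /high_gap (cardsD1 c) inE cC orientation_irr add1n ltnS.
apply: subset_leq_card; apply/subsetP => b.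
by rewrite !inE => /andP[neq /andP[bC ncb]]; rewrite bC clique_total // eq_sym.
Qed.

(** Adjacency is determined by the gaps alone, which reduces the verification
    of an induced subgraph to arithmetic. *)
Lemma adjE (u v : G) : adj u v =
  if u \in C then (low_gap u < low_gap v) || (high_gap v <= low_gap u)
  else (v \in C) && ((low_gap v < low_gap u) || (high_gap u <= low_gap v)).
Proof.
case: (boolP (u \in C)) (boolP (v \in C)) => uC [] vC /=.
- by rewrite (oP u v).1 below_clique // above_clique.
- by rewrite (oP u v).1 below_clique // above_clique.
- by rewrite adj_sym (oP v u).1 below_clique // above_clique.
- exact/negbTE/independent_nonadj.
Qed.

(** The jumps of the low gaps give [c3] (adjacent to [y] and [z]) and [c2]
    (adjacent to [z] only), those of the high gaps give [c1] (adjacent to [x]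
    only) and [c4] (adjacent to [x] and [y]).  Hence [y], [z], [x] play the roles
    of 5, 6, 7. *)
Lemma crossing_chain_B4 (x y z : G) :
  x \notin C -> y \notin C -> z \notin C ->
  crosses x y -> crosses y z -> induced_subgraph B4 G.
Proof.
move=> xC yC zC xy yz.
have [[c3 c3C lo3] [c1 c1C lo1]] := crosses_witnesses xy.
have [[c2 c2C lo2] [c4 c4C lo4]] := crosses_witnesses yz.
have lo_hi := low_le_high zC xC.
pose vs := [:: c1; c2; c3; c4; y; z; x].
have vs_uniq : uniq vs.
  rewrite (cat_uniq [:: c1; c2; c3; c4]); apply/and3P; split.
  - by apply: (@map_uniq _ _ low_gap); rewrite /= !inE;
      clear -lo1 lo2 lo3 lo4 lo_hi; lia.
  - apply/hasPn => v vI; have vC : v \notin C.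
      by move: vI; rewrite !inE => /or3P[] /eqP ->.
    by apply: contra vC; rewrite !inE => /or4P[] /eqP ->.
  - by apply: (@map_uniq _ _ low_gap); rewrite /= !inE;
      clear -lo1 lo2 lo3 lo4 lo_hi; lia.
exists (fun i : B4 => nth x vs (i : 'I_7)).
  by move=> i j /eqP; rewrite nth_uniq // => /eqP/ord_inj.
move=> [i li] [j lj]; rewrite /= /B4_adj /= adjE.
have := (high_gap_clique c1C, high_gap_clique c2C,
         high_gap_clique c3C, high_gap_clique c4C) => -[[[h1 h2] h3] h4].
move: lo1 lo2 lo3 lo4 lo_hi {vs_uniq xy yz}.
do 7?[case: i li => [|i] li //]; do 7?[case: j lj => [|j] lj //];
  rewrite !inE /= ?(c1C, c2C, c3C, c4C, negPf xC, negPf yC, negPf zC)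
    ?(h1, h2, h3, h4) ?xpair_eqE //=;
  move: (low_gap c1) (low_gap c2) (low_gap c3) (low_gap c4)
        (low_gap x) (low_gap y) (low_gap z)
        (high_gap x) (high_gap y) (high_gap z); clear; lia.
Qed.

End SplitComparability.

(** * The permutation-representation number *)

Theorem theorem6 (G : sgraph) (I C : {set G}) :
  split_partition I C -> comparability G ->
  (exists2 k : nat, perm_rep_number G k & k <= 3) /\
  (perm_rep_number G 3 <-> induced_subgraph B4 G).
Proof.
case=> IC _ I_indep C_clique _ [o oP o_trans].
have nC_indep : independent (~: C).
  by apply: sub_in2 I_indep => x; have := in_setT x; rewrite -IC !inE;
    case: (x \in I); case: (x \in C).
have rep3 := representable3 oP o_trans C_clique nC_indep.
have B4_min : induced_subgraph B4 G -> perm_rep_number G 3.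
  by move=> B4G; split=> // j; apply: perm_representable_B4.
pose chain := [exists x in ~: C, exists y in ~: C, exists z in ~: C,
                 crosses C o x y && crosses C o y z].
case: (boolP chain) => [|no_chain].
  case/existsP=> x /andP[xC /existsP[y /andP[yC /existsP[z]]]].
  rewrite !inE in xC yC * => /and3P[zC xy yz].
  have B4G : induced_subgraph B4 G by apply: (crossing_chain_B4 oP o_trans
    C_clique nC_indep xC yC zC).
  by split; [exists 3; first exact: B4_min | split=> // _; exact: B4_min].
have rep2 : perm_representable G 2.
  apply: (representable2 oP o_trans C_clique nC_indep) => x y z xC yC zC xy yz.
  case/negP: no_chain; apply/existsP; exists x; rewrite inE xC /=.
  apply/existsP; exists y; rewrite inE yC /=.
  by apply/existsP; exists z; rewrite inE zC xy.
split; last first.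
  by split=> [[_ /(_ 2 rep2)]//|/B4_min].
case: (boolP [forall a : G, forall b : G, (a != b) ==> adj a b]) => [cpl|ncpl].
  exists 1 => //; split=> [|j []//]; apply/perm_representable1 => a b.
  by move/forallP: cpl => /(_ a)/forallP/(_ b)/implyP.
exists 2 => //; split=> // -[|[|//]]; first by case.
move/perm_representable1 => cpl; case/negP: ncpl.
by do 2!apply/forallP => ?; apply/implyP; apply: cpl.
Qed.
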